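(* Let $(X,\Sigma,\lambda)$ be a positive measure space and let $f\in L_\infty(X)$ be non-zero. Then $f$ is smooth if and only if there exists a $\lambda$-atom $A$ such that $|f(x)|=\|f\|_\infty$ for almost every $x\in A$ and $$\lambda\left(\{x\in X\setminus A:|f(x)|>\|f\|_\infty-\epsilon\}\right)=0$$ for some $\epsilon>0$.
   Context: $\mathbb{K}$ is $\mathbb{R}$ or $\mathbb{C}$. $L_\infty(X)=L_\infty^{\mathbb{K}}(X,\Sigma,\lambda)$ is the space of essentially bounded measurable $\mathbb{K}$-valued functions (modulo a.e. equality) with the essential supremum norm $\|\cdot\|_\infty$; the measure is arbitrary (no finiteness or $\sigma$-finiteness is assumed). A set $A\in\Sigma$ is a $\lambda$-atom if $\lambda(A)>0$ and for every $B\in\Sigma$ with $B\subset A$ and $\lambda(B)>0$ one has $\lambda(A\setminus B)=0$ (i.e. $B=A$ up to a null set). For a normed space $\mathbb{X}$ over $\mathbb{K}$ with continuous dual $\mathbb{X}^*$ and non-zero $x\in\mathbb{X}$, $J(x):=\{\varphi\in\mathbb{X}^*:\|\varphi\|=1,\ \varphi(x)=\|x\|\}$; a non-zero $x$ is smooth if $J(x)$ is a singleton. *)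

(* Defs.v *)
From HB Require Import structures.
From mathcomp Require Import all_boot all_order all_algebra.
From mathcomp Require Import all_classical all_reals all_analysis.
From mathcomp Require Import ess_sup_inf hoelder.
From mathcomp Require Import complex.

Set Implicit Arguments.
Unset Strict Implicit.
Unset Printing Implicit Defensive.

Import Order.TTheory GRing.Theory Num.Theory.
Import numFieldNormedType.Exports.

Local Open Scope classical_set_scope.
Local Open Scope ring_scope.

Section smoothness.
Context {K : numFieldType} {V : normedModType K}.

Definition continuous_dual : set (V -> K) :=
  [set phi | linear (phi : V -> K^o) /\ continuous phi].

(* Norms take their values in [K] (for [K = R[i]], in its nonnegative reals),
   so this supremum is taken in the partial order of [K]. It exists for every
   continuous linear functional when [K] is the field of real or complex
   numbers. *)
Definition dual_norm (phi : V -> K) : K :=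
  supremum 0 [set `|phi x| | x in [set x : V | `|x| <= 1]].

Definition support_functionals (x : V) : set (V -> K) :=
  [set phi | [/\ continuous_dual phi, dual_norm phi = 1 & phi x = `|x|]].

Definition smooth (x : V) : Prop :=
  x != 0 /\ exists phi, support_functionals x = [set phi].

End smoothness.

Definition atom d (X : measurableType d) (R : realType)
    (lambda : {measure set X -> \bar R}) (A : set X) : Prop :=
  [/\ measurable A, (0 < lambda A)%E &
      forall B, measurable B -> B `<=` A -> (0 < lambda B)%E ->
        lambda (A `\` B) = 0].

Definition borel (T : ptopologicalType) := g_sigma_algebraType (@open T).

Section borel_measurable.
Context d (X : measurableType d).

Lemma borel_measurableP (K : ptopologicalType) (f : X -> K) :
  measurable_fun setT (f : X -> borel K) <->
  (forall U : set K, open U -> measurable (f @^-1` U)).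
Proof.
split=> [mf U oU|mf].
  by rewrite -[X in measurable X]setTI; apply: mf => //; exact: sub_sigma_algebra.
apply: (@measurability _ _ _ (borel K) setT f (@open K)) => //.
by move=> _ [U oU <-]; rewrite setTI; exact: mf.
Qed.

Lemma borel_measurable_comp (K L : ptopologicalType) (f : X -> K) (h : K -> L) :
  continuous h -> measurable_fun setT (f : X -> borel K) ->
  measurable_fun setT (h \o f : X -> borel L).
Proof.
move=> hc /borel_measurableP mf; apply/borel_measurableP => U oU.
by rewrite comp_preimage; apply: mf; apply: open_comp => // x _; exact: hc.
Qed.

Lemma borel_measurable_comp2 (K : ptopologicalType) (f g : X -> K)
    (h : K * K -> K) : @second_countable K -> continuous h ->
  measurable_fun setT (f : X -> borel K) ->
  measurable_fun setT (g : X -> borel K) ->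
  measurable_fun setT ((fun x => h (f x, g x)) : X -> borel K).
Proof.
move=> [B cB [oB bB]] hc /borel_measurableP mf /borel_measurableP mg.
apply/borel_measurableP => U oU.
pose D := [set P : set K * set K |
  [/\ B P.1, B P.2 & P.1 `*` P.2 `<=` h @^-1` U]].
have -> : (fun x => h (f x, g x)) @^-1` U =
    \bigcup_(P in D) (f @^-1` P.1 `&` g @^-1` P.2).
  apply/seteqP; split=> [x Ux|x [P [_ _ PU] [fP gP]]]; last exact: (PU (_, _)).
  have : nbhs (f x, g x) (h @^-1` U).
    by apply: hc; exact: open_nbhs_nbhs.
  move=> [[S T] /= [nS nT] STU].
  have [P [BP Pf] PS] := bB _ _ nS; have [Q [BQ Qg] QT] := bB _ _ nT.
  exists (P, Q) => //; split=> //= z [z1 z2].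
  by apply: STU; split; [exact: PS|exact: QT].
rewrite bigcup_set_type; apply: countable_bigcupT_measurable.
  rewrite (eq_countable (card_setT _)).
  apply: (@sub_countable _ _ _ (B `*` B)); last exact: countableX.
  by apply: subset_card_le => -[P Q] [].
move=> [P /set_mem [B1 B2 _]] /=; apply: measurableI; first exact/mf/oB.
exact/mg/oB.
Qed.

End borel_measurable.

Lemma second_countable_of_dense (K : numFieldType) (I : countType) (D : I -> K) :
  (forall (x e : K), 0 < e -> exists i, `|x - D i| < e) ->
  (forall e : K, 0 < e -> exists n, n.+1%:R^-1 < e) ->
  @second_countable K.
Proof.
move=> dD arch.
exists (range (fun p : I * nat => ball (D p.1) (p.2.+1%:R^-1 : K))).
  by apply: card_le_trans (card_image_le _ _) _; exact: countableP.
split=> [_ [p _ <-]|x U]; first exact: ball_open.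
rewrite -nbhs_ballE => -[e e0 xeU].
have [n ne] := arch _ (divr_gt0 e0 (ltr0Sn K 1)).
have n0 : (0 : K) < n.+1%:R^-1 by rewrite invr_gt0.
have [i xi] := dD x _ n0.
exists (ball (D i) n.+1%:R^-1).
  by split; [exists (i, n)|rewrite -ball_normE /= distrC].
move=> y; rewrite -ball_normE /= => yi; apply: xeU; rewrite -ball_normE /=.
rewrite (splitr e) (le_lt_trans (ler_distD (D i) _ _))// ltrD//.
  exact: lt_trans ne.
exact: lt_trans ne.
Qed.

Inductive scalar_kind := real_scalars | complex_scalars.

Definition scalar_field (R : realType) (k : scalar_kind) : numFieldType :=
  match k with real_scalars => R | complex_scalars => R[i] end.

Definition of_real (R : realType) (k : scalar_kind) : R -> scalar_field R k :=
  match k with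
  | real_scalars => id
  | complex_scalars => fun x => (x +i* 0)%C
  end.

(* The norm of a [numFieldType] takes its values in the field itself; this is
   its real-valued version. *)
Definition modulus (R : realType) (k : scalar_kind) : scalar_field R k -> R :=
  match k with
  | real_scalars => fun x : R => `|x|
  | complex_scalars => @ComplexField.Normc.normc R
  end.

Section scalar_theory.
Context {R : realType} {k : scalar_kind}.
Local Notation K := (scalar_field R k).
Local Notation of_real := (@of_real R k).
Implicit Types (x y : K) (a b : R).

Lemma of_real_modulus x : of_real (modulus x) = `|x|.
Proof. by case: k x => x. Qed.

Lemma ler_of_real a b : (of_real a <= of_real b) = (a <= b).
Proof. by rewrite /of_real; case: k => //=; rewrite lecE /= eqxx. Qed.

Lemma ltr_of_real a b : (of_real a < of_real b) = (a < b).
Proof. by rewrite /of_real; case: k => //=; rewrite ltcE /= eqxx. Qed.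

Lemma of_real0 : of_real 0 = 0.
Proof. by rewrite /of_real; case: k. Qed.

Lemma of_real1 : of_real 1 = 1.
Proof. by rewrite /of_real; case: k. Qed.

Lemma of_realD a b : of_real (a + b) = of_real a + of_real b.
Proof.
by rewrite /of_real; case: k => //=; apply/eqP; rewrite eq_complex /= addr0 !eqxx.
Qed.

Lemma of_realM a b : of_real (a * b) = of_real a * of_real b.
Proof.
rewrite /of_real; case: k => //=; apply/eqP.
by rewrite eq_complex /= mulr0 mul0r mulr0 subr0 addr0 !eqxx.
Qed.

Lemma of_real_inj : injective of_real.
Proof. by move=> a b ab; apply/eqP; rewrite eq_le -!ler_of_real ab lexx. Qed.

Lemma modulus_ge0 x : 0 <= modulus x.
Proof. by rewrite -ler_of_real of_real_modulus of_real0. Qed.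

Lemma ler_modulusD x y : modulus (x + y) <= modulus x + modulus y.
Proof. by rewrite -ler_of_real of_realD !of_real_modulus ler_normD. Qed.

Lemma modulusM x y : modulus (x * y) = modulus x * modulus y.
Proof. by apply: of_real_inj; rewrite of_realM !of_real_modulus normrM. Qed.

Lemma modulus0 : modulus (0 : K) = 0.
Proof. by apply: of_real_inj; rewrite of_real_modulus of_real0 normr0. Qed.

Lemma modulus_eq0 x : modulus x = 0 -> x = 0.
Proof.
by move=> x0; apply/normr0_eq0; rewrite -of_real_modulus x0 of_real0.
Qed.

End scalar_theory.

Lemma scalar_second_countable (R : realType) (k : scalar_kind) :
  @second_countable (scalar_field R k).
Proof.
have archR (e : R) : 0 < e -> exists n, n.+1%:R^-1 < e.
  move=> e0; exists (Num.truncn e^-1).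
  by rewrite invf_plt ?posrE ?ltr0n// truncnS_gt.
have densR (x e : R) : 0 < e -> exists q : rat, `|x - ratr q| < e.
  move=> e0; have [|q] := @rat_in_itvoo R (x - e) (x + e).
    by rewrite ltrD2l gtrN.
  by rewrite in_itv /= => xq; exists q; rewrite distrC ltr_distl.
case: k.
  exact: (@second_countable_of_dense R _ ratr).
apply: (@second_countable_of_dense R[i] _
    (fun q : rat * rat => (ratr q.1 +i* ratr q.2)%C)) => [[a b] [e e'] /=|].
  rewrite ltcE /= => /andP[/eqP-> e0].
  have [p ap] := densR a _ (divr_gt0 e0 (ltr0Sn _ 1)).
  have [q bq] := densR b _ (divr_gt0 e0 (ltr0Sn _ 1)).
  exists (p, q); rewrite ltcE /= eqxx /=.
  rewrite (@le_lt_trans _ _ (`|a - ratr p| + `|b - ratr q|))//; last first.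
    by rewrite (splitr e) ltrD.
  rewrite -(ler_pXn2r (n := 2))// ?nnegrE ?sqrtr_ge0 ?addr_ge0//.
  rewrite sqr_sqrtr ?addr_ge0 ?sqr_ge0//.
  rewrite [leRHS]sqrrD !real_normK ?num_real// addrAC lerDl mulrn_wge0//.
move=> [e e']; rewrite ltcE /= => /andP[/eqP-> e0].
have [n ne] := archR _ e0; exists n.
have -> : (n.+1%:R^-1 : R[i]) = (n.+1%:R^-1 +i* 0)%C.
  by rewrite -[RHS]/(real_complex R n.+1%:R^-1) fmorphV rmorph_nat.
by rewrite ltcE /= eqxx.
Qed.

Section essentially_bounded.
Context d (X : measurableType d) (R : realType) (k : scalar_kind).
Variable lambda : {measure set X -> \bar R}.
Local Notation K := (scalar_field R k).

Definition ess_norm (f : X -> K) : \bar R := 'N[lambda]_+oo[EFin \o (@modulus R k \o f)].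

Definition ess_bounded : {pred X -> K} := [pred f |
  `[< measurable_fun setT (f : X -> borel K) /\ (ess_norm f < +oo)%E >]].

Lemma ess_boundedP (f : X -> K) : reflect
  (measurable_fun setT (f : X -> borel K) /\ (ess_norm f < +oo)%E)
  (f \in ess_bounded).
Proof. exact: asboolP. Qed.

Lemma ess_norm_ge0 (f : X -> K) : (0 <= ess_norm f)%E.
Proof. exact: Lnorm_ge0. Qed.

Lemma ess_norm_leP (f : X -> K) (M : R) : 0 <= M ->
  (ess_norm f <= M%:E)%E <-> (\forall x \ae lambda, modulus (f x) <= M).
Proof.
move=> M0; rewrite /ess_norm unlock; case: ifPn => [_|X0].
  split=> [/ess_supP|] fM; [|apply/ess_supP]; apply: filterS fM => x /=;
  by rewrite lee_fin ger0_norm// modulus_ge0.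
split=> _; last by rewrite lee_fin.
by apply: measure0_ae; apply/eqP; rewrite eq_le measure_ge0 leNgt X0.
Qed.

Lemma ess_norm_ltyP (f : X -> K) : (ess_norm f < +oo)%E <->
  exists2 M : R, 0 <= M & \forall x \ae lambda, modulus (f x) <= M.
Proof.
split=> [foo|[M M0 /(ess_norm_leP f M0)]]; last first.
  by move/le_lt_trans; apply; rewrite ltry.
have fE : (fine (ess_norm f))%:E = ess_norm f.
  by rewrite fineK// ge0_fin_numE// ess_norm_ge0.
exists (fine (ess_norm f)); first exact/fine_ge0/ess_norm_ge0.
by apply/ess_norm_leP; [exact/fine_ge0/ess_norm_ge0|rewrite fE].
Qed.

Lemma ess_bounded_submod_closed : submod_closed ess_bounded.
Proof.
split.
  apply/ess_boundedP; split.
    apply/borel_measurableP => U _; rewrite preimage_cst.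
    by case: ifP => _; [exact: measurableT|exact: measurable0].
  by apply/ess_norm_ltyP; exists 0 => //; apply: aeW => x; rewrite modulus0.
move=> a f g /ess_boundedP[mf /ess_norm_ltyP[M M0 fM]].
move=> /ess_boundedP[mg /ess_norm_ltyP[N N0 gN]].
apply/ess_boundedP; split.
  apply: (@borel_measurable_comp2 _ X K f g (fun p => a *: (p.1 : K^o) + p.2)) => //.
  - exact: scalar_second_countable.
  - move=> p; apply: cvgD; last exact: cvg_snd.
    by apply: cvgZr; exact: cvg_fst.
apply/ess_norm_ltyP; exists (modulus a * M + N).
  by rewrite addr_ge0// mulr_ge0// modulus_ge0.
apply: filterS2 fM gN => x fM gN.
rewrite (le_trans (ler_modulusD _ _))// lerD// modulusM ler_wpM2l//.
exact: modulus_ge0.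
Qed.

HB.instance Definition _ :=
  GRing.isSubmodClosed.Build K (X -> K) ess_bounded ess_bounded_submod_closed.

Record ess_bounded_fun := EssBoundedFun {
  ess_bounded_val :> X -> K;
  _ : ess_bounded_val \in ess_bounded }.

HB.instance Definition _ := [isSub for ess_bounded_val].
HB.instance Definition _ := [Choice of ess_bounded_fun by <:].
HB.instance Definition _ := [SubChoice_isSubLmodule of ess_bounded_fun by <:].

Definition ae_equal (f g : ess_bounded_fun) : bool :=
  `[< \forall x \ae lambda, f x = g x >].

Lemma ae_equalP (f g : ess_bounded_fun) : reflect (\forall x \ae lambda, f x = g x) (ae_equal f g).
Proof. exact: asboolP. Qed.

Lemma ae_equal_equiv : equiv_class_of ae_equal.
Proof.
split=> [f|f g|g f h /ae_equalP fg /ae_equalP gh].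
- by apply/ae_equalP/aeW.
- by apply/ae_equalP/ae_equalP; apply: filterS => x.
- by apply/ae_equalP; apply: filterS2 fg gh => x ->.
Qed.

Canonical ae_equal_equivRel := EquivRelPack ae_equal_equiv.

Local Open Scope quotient_scope.

Definition Linf : Type := {eq_quot ae_equal}.
HB.instance Definition _ := Choice.on Linf.
HB.instance Definition _ := EqQuotient.on Linf.

Definition Linf_fun (f : Linf) : X -> K := repr f.
Coercion Linf_fun : Linf >-> Funclass.

Lemma LinfP (f g : Linf) : f = g <-> \forall x \ae lambda, f x = g x.
Proof.
split=> [->|fg]; first exact: aeW.
by rewrite -(reprK f) -(reprK g); apply/eqmodP/ae_equalP.
Qed.

Lemma Linf_piE (f : ess_bounded_fun) :
  \forall x \ae lambda, (\pi_Linf f : Linf) x = f x.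
Proof. by apply/ae_equalP; apply/eqmodP; rewrite reprK. Qed.

Implicit Types f g h : Linf.

Let zero : Linf := \pi_Linf 0.
Let opp (f : Linf) : Linf := \pi_Linf (- repr f).
Let add (f g : Linf) : Linf := \pi_Linf (repr f + repr g).
Let scale (a : K) (f : Linf) : Linf := \pi_Linf (a *: repr f).

Let zeroE : \forall x \ae lambda, zero x = 0.
Proof. exact: Linf_piE. Qed.
Let oppE f : \forall x \ae lambda, opp f x = - f x.
Proof. exact: Linf_piE. Qed.
Let addE f g : \forall x \ae lambda, add f g x = f x + g x.
Proof. exact: Linf_piE. Qed.
Let scaleE a f : \forall x \ae lambda, scale a f x = a * f x.
Proof. exact: Linf_piE. Qed.

Let addA : associative add.
Proof.
move=> f g h; apply/LinfP.
near=> x; rewrite (near (addE _ _) x)// (near (addE g h) x)//.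
by rewrite (near (addE (add f g) h) x)// (near (addE f g) x)// addrA.
Unshelve. all: by end_near. Qed.

Let addC : commutative add.
Proof.
move=> f g; apply/LinfP.
by near=> x; rewrite (near (addE f g) x)// (near (addE g f) x)// addrC.
Unshelve. all: by end_near. Qed.

Let add0 : left_id zero add.
Proof.
move=> f; apply/LinfP.
by near=> x; rewrite (near (addE zero f) x)// (near zeroE x)// add0r.
Unshelve. all: by end_near. Qed.

Let addN : left_inverse zero opp add.
Proof.
move=> f; apply/LinfP; near=> x.
by rewrite (near (addE _ f) x)// (near (oppE f) x)// (near zeroE x)// addNr.
Unshelve. all: by end_near. Qed.

HB.instance Definition _ := GRing.isZmodule.Build Linf addA addC add0 addN.

Let scaleA a b f : scale a (scale b f) = scale (a * b) f.
Proof.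
apply/LinfP; near=> x.
rewrite (near (scaleE a _) x)// (near (scaleE b f) x)//.
by rewrite (near (scaleE _ f) x)// mulrA.
Unshelve. all: by end_near. Qed.

Let scale1 : left_id 1 scale.
Proof.
by move=> f; apply/LinfP; near=> x; rewrite (near (scaleE 1 f) x)// mul1r.
Unshelve. all: by end_near. Qed.

Let scaleDr : right_distributive scale +%R.
Proof.
move=> a f g; apply/LinfP; near=> x.
rewrite (near (scaleE a _) x)// (near (addE f g) x)//.
rewrite (near (addE (scale a f) _) x)// (near (scaleE a f) x)//.
by rewrite (near (scaleE a g) x)// mulrDr.
Unshelve. all: by end_near. Qed.

Let scaleDl f : {morph scale^~ f : a b / a + b}.
Proof.
move=> a b; apply/LinfP; near=> x.
rewrite (near (scaleE _ f) x)// (near (addE (scale a f) _) x)//.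
by rewrite (near (scaleE a f) x)// (near (scaleE b f) x)// mulrDl.
Unshelve. all: by end_near. Qed.

HB.instance Definition _ :=
  GRing.Zmodule_isLmodule.Build K Linf scaleA scale1 scaleDr scaleDl.

Lemma Linf0E : \forall x \ae lambda, (0 : Linf) x = 0.
Proof. exact: zeroE. Qed.

Lemma LinfDE (f g : Linf) : \forall x \ae lambda, (f + g : Linf) x = f x + g x.
Proof. exact: addE. Qed.

Lemma LinfZE (a : K) (f : Linf) : \forall x \ae lambda, (a *: f : Linf) x = a * f x.
Proof. exact: scaleE. Qed.

Definition Linf_norm (f : Linf) : R := fine (ess_norm f).

Lemma Linf_norm_ge0 (f : Linf) : 0 <= Linf_norm f.
Proof. exact/fine_ge0/ess_norm_ge0. Qed.

Lemma ess_norm_lty (f : Linf) : (ess_norm f < +oo)%E.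
Proof. by have /ess_boundedP[] := valP (repr f). Qed.

Lemma Linf_norm_leP (f : Linf) (M : R) : 0 <= M ->
  Linf_norm f <= M <-> \forall x \ae lambda, modulus (f x) <= M.
Proof.
move=> M0; rewrite -ess_norm_leP// -lee_fin /Linf_norm fineK//.
by rewrite ge0_fin_numE ?ess_norm_ge0// ess_norm_lty.
Qed.

Lemma ae_le_Linf_norm (f : Linf) :
  \forall x \ae lambda, modulus (f x) <= Linf_norm f.
Proof. by apply/Linf_norm_leP => //; exact: Linf_norm_ge0. Qed.

Let norm (f : Linf) : K := of_real k (Linf_norm f).

Let normD f g : norm (f + g) <= norm f + norm g.
Proof.
rewrite /norm -of_realD ler_of_real.
apply/Linf_norm_leP; first by rewrite addr_ge0 ?Linf_norm_ge0.
near=> x; rewrite (near (LinfDE f g) x)//.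
rewrite (le_trans (ler_modulusD _ _))// lerD//.
  by rewrite (near (ae_le_Linf_norm f) x).
by rewrite (near (ae_le_Linf_norm g) x).
Unshelve. all: by end_near. Qed.

Let Linf_norm0 : Linf_norm 0 = 0.
Proof.
apply/eqP; rewrite eq_le Linf_norm_ge0 andbT; apply/Linf_norm_leP => //.
by near=> x; rewrite (near Linf0E x)// modulus0.
Unshelve. all: by end_near. Qed.

Let Linf_normZ_le a f : Linf_norm (a *: f) <= modulus a * Linf_norm f.
Proof.
apply/Linf_norm_leP; first by rewrite mulr_ge0 ?modulus_ge0 ?Linf_norm_ge0.
near=> x; rewrite (near (LinfZE a f) x)// modulusM ler_wpM2l ?modulus_ge0//.
by rewrite (near (ae_le_Linf_norm f) x).
Unshelve. all: by end_near. Qed.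

Let normZ a f : norm (a *: f) = `|a| * norm f.
Proof.
rewrite /norm -of_real_modulus -of_realM; congr of_real.
apply/eqP; rewrite eq_le Linf_normZ_le /=.
have [->|a0] := eqVneq a 0; first by rewrite modulus0 mul0r Linf_norm_ge0.
have aV : modulus a * modulus a^-1 = 1.
  rewrite -modulusM divff//; apply: (@of_real_inj R k).
  by rewrite of_real_modulus normr1 of_real1.
have a_ge0 := modulus_ge0 a.
have := ler_wpM2l a_ge0 (Linf_normZ_le a^-1 (a *: f)).
by rewrite mulrA aV mul1r scalerA mulVf// scale1r.
Qed.

Let norm_eq0 f : norm f = 0 -> f = 0.
Proof.
rewrite /norm -(@of_real0 R k) => /of_real_inj f0; apply/LinfP; near=> x.
rewrite (near Linf0E x)//; apply: modulus_eq0; apply/eqP.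
by rewrite eq_le modulus_ge0 andbT -f0 (near (ae_le_Linf_norm f) x).
Unshelve. all: by end_near. Qed.

HB.instance Definition _ :=
  Lmodule_isNormed.Build K Linf normD normZ norm_eq0.

Lemma Linf_normE (f : Linf) : `|f| = of_real k (fine (ess_norm f)).
Proof. by []. Qed.

End essentially_bounded.

Arguments Linf {d X R} k lambda.

(* Main.v *)
Require Import Defs.
From mathcomp Require Import all_boot all_order all_algebra.
From mathcomp Require Import all_classical all_reals all_analysis.
From mathcomp Require Import complex.

Set Implicit Arguments.
Unset Strict Implicit.
Unset Printing Implicit Defensive.

Import Order.TTheory GRing.Theory Num.Theory.
Import numFieldNormedType.Exports.
Local Open Scope classical_set_scope.
Local Open Scope ring_scope.

(** The norm of [f] is only seen by the filter of sets that contain, up to a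
    null set, some peak [{|f| > |f|_oo - e}] with [e > 0] ([peak_filter]).
    The theorem holds because smoothness of [f] means that this filter decides
    every measurable set, and a filter with a decreasing sequence of generators
    can only do so by being concentrated on one atom.

    Every ultrafilter [U] above the peak filter gives a support functional, the
    limit along [U] of [g * |f| / f] ([peak_functional_support]); bounded scalar
    functions converge along ultrafilters ([ultra_cvg_scalar]). If some
    measurable [B] and its complement both meet all peaks in positive measure,
    two ultrafilters, one containing [B] and one containing [~` B], give
    functionals that differ on the restriction of [f] to [B]. So if [f] is
    smooth, each measurable [B] contains, or is disjoint from, a peak up to a
    null set ([smooth_decides]). Applied to the union of every second shell
    between successive peaks, this forces the peaks
    [{|f| > |f|_oo - 1 / (n + 1)}] to be eventually constant up to null sets
    ([decided_eventually_constant]); the constant value [A] is an atom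
    ([decided_atom]), and [|f| = |f|_oo] a.e. on it because it lies in all the
    peaks ([smooth_peak_atom]).

    Conversely, let [A] be an atom on which [|f| = |f|_oo] a.e. and off which
    [|f| <= |f|_oo - e] a.e. A small multiple of a function [h] that vanishes
    a.e. on [A] can be added to [f] without increasing its norm, so a support
    functional kills [h] ([support_functional_eq0]). Measurable scalar functions
    are a.e. constant on an atom ([atom_ae_const]), so every [g] differs from a
    multiple of [f] by such an [h], which determines the functional
    ([support_functional_unique]). Existence is again given by an
    ultrafilter. *)

(** * Scalars and limits along ultrafilters *)

Lemma ultra_cvg_real (T : Type) (R : realType) (U : set_system T) (h : T -> R)
    (C : R) : UltraFilter U -> U [set x | `|h x| <= C] ->
  exists l : R, h x @[x --> U] --> l.
Proof.
move=> UU UC.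
have cpt := @segment_compact R (- C) C.
rewrite compact_ultra in cpt.
(* the image of an ultrafilter decides every set, hence is maximal *)
have hUU : UltraFilter (h @ U).
  split=> [|G PG sG]; first exact: fmap_proper_filter.
  rewrite eqEsubset; split=> // S GS /=.
  have [//|UnS] := in_ultra_setVsetC (h @^-1` S) UU.
  have /(filterI GS) : G (~` S) by exact: sG.
  by rewrite setICr => /filter_not_empty.
have /cpt[] : (h @ U) `[- C, C]%classic.
  by apply: (@filterS _ U _ _ _ _ UC) => x; rewrite /= in_itv /= -ler_norml.
by move=> l [_ hl]; exists l.
Qed.

Section scalars.
Context {R : realType} {k : scalar_kind}.
Local Notation K := (scalar_field R k).
Implicit Type z : K.

Lemma gt0_of_real z : 0 < z -> exists2 e : R, 0 < e & z = of_real k e.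
Proof.
move=> z0; exists (modulus z).
  by rewrite -(@ltr_of_real R k) of_real0 of_real_modulus normr_gt0 gt_eqF.
by rewrite of_real_modulus gtr0_norm.
Qed.

Lemma of_realN (a : R) : of_real k (- a) = - of_real k a.
Proof. by apply/eqP; rewrite -addr_eq0 -of_realD addNr of_real0. Qed.

Lemma of_real_norm (a : R) : `|of_real k a| = of_real k `|a|.
Proof.
have [a0|a0] := leP 0 a.
  by rewrite !ger0_norm// -(@of_real0 R k) ler_of_real.
by rewrite !ltr0_norm// ?of_realN// -(@of_real0 R k) ltr_of_real.
Qed.

Lemma ler_modulus_norm z (a : R) : (modulus z <= a) = (`|z| <= of_real k a).
Proof. by rewrite -of_real_modulus ler_of_real. Qed.

Lemma modulus_le0 z : modulus z <= 0 -> z = 0.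
Proof.
by move=> z0; apply: modulus_eq0; apply/eqP; rewrite eq_le z0 modulus_ge0.
Qed.

Lemma open_modulus_gt (r : R) : open [set x : K | r < modulus x].
Proof.
rewrite openE => x /= rx.
rewrite /interior -nbhs_ballE; exists (`|x| - of_real k r).
  by rewrite /= subr_gt0 -of_real_modulus ltr_of_real.
move=> y; rewrite -ball_normE /= => xy.
rewrite -(@ltr_of_real R k) of_real_modulus -(ltrD2l (`|x| - `|y|)) subrK.
rewrite addrC -ltrBrDl (le_lt_trans (lerB_dist _ _))//.
Qed.

End scalars.

Section scalar_limits.
Context {R : realType} {k : scalar_kind}.
Local Notation K := (scalar_field R k).

(** Complex functions are handled through their real and imaginary parts,
    whose absolute values are bounded by the modulus. *)
Lemma ultra_cvg_scalar (T : Type) (U : set_system T) (h : T -> K) (C : R) :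
  UltraFilter U -> U [set x | modulus (h x) <= C] ->
  exists l : K, h x @[x --> U] --> l.
Proof.
move=> UU; case: k h => h UC; first exact: ultra_cvg_real UC.
have normcE (z : R[i]) : `|complex.Re z| <= ComplexField.Normc.normc z /\
    `|complex.Im z| <= ComplexField.Normc.normc z.
  case: z => a b /=; rewrite -!sqrtr_sqr !ler_wsqrtr//.
    by rewrite lerDr sqr_ge0.
  by rewrite lerDl sqr_ge0.
have [|a ha] := @ultra_cvg_real T R U (fun x => complex.Re (h x)) C UU.
  by apply: filterS UC => x /=; apply: le_trans; have [] := normcE (h x).
have [|b hb] := @ultra_cvg_real T R U (fun x => complex.Im (h x)) C UU.
  by apply: filterS UC => x /=; apply: le_trans; have [] := normcE (h x).
exists (a +i* b)%C; apply/cvgrPdist_lt.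
move=> _ /(@gt0_of_real _ complex_scalars)[e e0 ->].
have e20 : 0 < e / 2 by rewrite divr_gt0.
move/cvgrPdist_lt : ha => /(_ _ e20); move/cvgrPdist_lt : hb => /(_ _ e20).
apply: filterS2 => x; case: (h x) => u v /= bv au.
rewrite ltcE /= eqxx /= (@le_lt_trans _ _ (`|a - u| + `|b - v|))//; last first.
  by rewrite (splitr e) ltrD.
rewrite -(ler_pXn2r (n := 2))// ?nnegrE ?sqrtr_ge0 ?addr_ge0//.
rewrite sqr_sqrtr ?addr_ge0 ?sqr_ge0//.
by rewrite [leRHS]sqrrD !real_normK ?num_real// addrAC lerDl mulrn_wge0.
Qed.

Lemma cvg_norm_le (T : Type) (F : set_system T) (h : T -> K) (l : K) (C : R) :
  ProperFilter F -> F [set x | modulus (h x) <= C] -> h x @[x --> F] --> l ->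
  `|l| <= of_real k C.
Proof.
move=> PF FC hl; rewrite -of_real_modulus ler_of_real leNgt; apply/negP => Cl.
have lC : of_real k C < `|l| by rewrite -of_real_modulus ltr_of_real.
have FC' : F [set x | of_real k C < `|h x|].
  exact: (@cvgr_norm_gt _ _ _ _ (@filter_filter _ _ PF) h l hl _ lC).
have [x [/=]] := @filter_ex _ F PF _ (@filterI _ F _ _ _ FC FC').
by rewrite -of_real_modulus ltr_of_real => /le_gtF ->.
Qed.

End scalar_limits.

(** * Filters that decide all measurable sets *)

Section decided.
Context d (X : measurableType d) (R : realType).
Variable lambda : {measure set X -> \bar R}.

Lemma null_splitD (A B : set X) : measurable A -> measurable B ->
  lambda (A `&` B) = 0%E -> lambda (A `\` B) = 0%E -> lambda A = 0%E.
Proof.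
move=> mA mB AB ADB; apply/negligibleP => //.
rewrite -(setUIDK A B); apply: negligibleU.
  by apply/negligibleP => //; exact: measurableI.
by apply/negligibleP => //; exact: measurableD.
Qed.

(** Otherwise a strictly increasing subsequence [E (a j)] has shells
    [E (a j) `\` E (a j.+1)] of positive measure. The union of the shells of
    even index is then undecided: every [E n] contains an even shell and an odd
    one, since [n <= a n]. *)
Lemma decided_eventually_constant (E : nat -> set X) :
  (forall n, measurable (E n)) ->
  (forall n m, (n <= m)%N -> E m `<=` E n) ->
  (forall B, measurable B ->
    exists n, lambda (E n `&` B) = 0%E \/ lambda (E n `\` B) = 0%E) ->
  exists n, forall m, lambda (E n `\` E m) = 0%E.
Proof.
move=> mE dE decE; apply: contrapT => nE.
have next n : exists m, lambda (E n `\` E m) <> 0%E.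
  by move: nE => /forallNP/(_ n)/existsNP.
have {next}[s sP] := choice next.
pose a j := iter j s 0%N.
have sgt n : (n < s n)%N.
  rewrite ltnNge; apply/negP => /dE; rewrite -setD_eq0 => sn.
  by apply: (sP n); rewrite sn measure0.
have a_mono : {homo a : i j / (i <= j)%N}.
  by apply: homo_leq => [//|y x z|i]; [exact: leq_trans|exact/ltnW/sgt].
have a_ge i : (i <= a i)%N by elim: i => // i /leq_ltn_trans; apply; exact: sgt.
pose D j := E (a j) `\` E (a j.+1).
have mD j : measurable (D j) by exact: measurableD.
have Ddisj i j x : D i x -> D j x -> i = j.
  move=> [Ei nEi] [Ej nEj]; have [ij|ij|//] := ltngtP i j.
    by exfalso; apply: nEi; exact: dE (a_mono _ _ ij) _ Ej.
  by exfalso; apply: nEj; exact: dE (a_mono _ _ ij) _ Ei.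
pose B := \bigcup_j D j.*2.
have mB : measurable B by apply: bigcupT_measurable => j; exact: mD.
have [n [EB|EB]] := decE B mB.
  apply: (sP (a n.*2)); apply: subset_measure0 EB; first exact: mD.
    exact: measurableI.
  move=> x Dx; split; last by exists n.
  by apply: dE (proj1 Dx); rewrite (leq_trans _ (a_ge _))// -addnn leq_addr.
apply: (sP (a n.*2.+1)); apply: subset_measure0 EB; first exact: mD.
  exact: measurableD.
move=> x Dx; split.
  apply: dE (proj1 Dx); rewrite (leq_trans _ (a_ge _))//.
  by rewrite leqW// -addnn leq_addr.
move=> [j _ Djx]; have := Ddisj _ _ _ Dx Djx.
by move=> /(congr1 odd); rewrite /= !odd_double.
Qed.

(** The eventual value [E n] is an atom: a subset [B] that avoids some [E m] up
    to a null set is null, as [E n] and [E m] agree a.e., and a subset that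
    contains [E m] a.e. exhausts [E n]. *)
Lemma decided_atom (E : nat -> set X) :
  (forall n, measurable (E n)) ->
  (forall n m, (n <= m)%N -> E m `<=` E n) ->
  (forall n, (0 < lambda (E n))%E) ->
  (forall B, measurable B ->
    exists n, lambda (E n `&` B) = 0%E \/ lambda (E n `\` B) = 0%E) ->
  exists n, atom lambda (E n) /\ forall m, lambda (E n `\` E m) = 0%E.
Proof.
move=> mE dE E0 decE; have [n nE] := decided_eventually_constant mE dE decE.
exists n; split=> //; split=> // B mB BE B0.
have [m [EB|EB]] := decE B mB.
  exfalso; move: B0; rewrite (_ : lambda B = 0%E) ?ltxx//.
  apply: (@null_splitD B (E m)) => //; first by rewrite setIC.
  apply: subset_measure0 (nE m); [exact: measurableD|exact: measurableD|].
  exact: setSD.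
apply: (@null_splitD _ (E m)) => //; first exact: measurableD.
  apply: subset_measure0 EB; [|exact: measurableD|].
    by apply: measurableI => //; exact: measurableD.
  by move=> x [[_ nBx] Ex].
apply: subset_measure0 (nE m); [|exact: measurableD|].
  by apply: measurableD => //; exact: measurableD.
by move=> x [[Ex _] nEx].
Qed.

End decided.

(** * Support functionals *)

Section support.
Context {K : numFieldType} {V : normedModType K}.
Implicit Types (x y : V) (phi : V -> K).

Lemma functionalD phi x y : linear (phi : V -> K^o) ->
  phi (x + y) = phi x + phi y.
Proof. by move=> lphi; have := lphi 1 x y; rewrite !scale1r. Qed.

Lemma functional0 phi : linear (phi : V -> K^o) -> phi 0 = 0.
Proof.
by move=> lphi; apply: (addrI (phi 0)); rewrite -(functionalD _ _ lphi) !addr0.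
Qed.

Lemma functionalZ phi a x : linear (phi : V -> K^o) -> phi (a *: x) = a * phi x.
Proof.
by move=> lphi; have := lphi a x 0; rewrite (functional0 lphi) !addr0.
Qed.

Lemma functionalB phi x y : linear (phi : V -> K^o) ->
  phi (x - y) = phi x - phi y.
Proof.
move=> lphi; rewrite (functionalD _ _ lphi) -scaleN1r.
by rewrite (functionalZ _ _ lphi) mulN1r.
Qed.

(** [dual_norm] is a supremum in a partial order, with the default value [0]
    when there is none. So [dual_norm phi = 1] provides the bound, and
    conversely the bound is a maximum, attained at [x / |x|]. *)
Lemma support_functionalsP x phi : x != 0 ->
  support_functionals x phi <->
  [/\ linear (phi : V -> K^o), (forall y, `|phi y| <= `|y|) & phi x = `|x|].
Proof.
move=> x0; have nx0 : 0 < `|x| by rewrite normr_gt0.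
split=> [[[lphi _] phi1 phix]|[lphi phi_le phix]]; split=> //.
- have phi_ub : ubound [set `|phi y| | y in [set y | `|y| <= 1]] 1.
    have := phi1; rewrite /dual_norm /supremum; case: ifPn => [_ /esym/eqP|_].
      by rewrite oner_eq0.
    case: xgetP => [s _ [ubs _] s1|_ /esym/eqP]; first by rewrite s1 in ubs.
    by rewrite oner_eq0.
  move=> y; have [->|y0] := eqVneq y 0; first by rewrite (functional0 lphi) normr0.
  have ny0 : 0 < `|y| by rewrite normr_gt0.
  have : `|phi (`|y|^-1 *: y)| <= 1.
    apply: phi_ub; exists (`|y|^-1 *: y) => //.
    by rewrite /= normrZ normfV normr_id mulVf// gt_eqF.
  rewrite (functionalZ _ _ lphi) normrM normfV normr_id.
  by rewrite mulrC ler_pdivrMr// mul1r.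
- split=> // y; apply/cvgrPdist_lt => e e0.
  apply/nbhs_normP; exists e => //= z; rewrite /= => yz.
  by rewrite -(functionalB _ _ lphi) (le_lt_trans (phi_le _)).
- rewrite /dual_norm /supremum ifF; last first.
    apply/negP => /eqP S0; have : set0 `|phi 0|; last by [].
    by rewrite -S0; exists 0 => //=; rewrite normr0.
  apply: xget_subset1; last exact: is_subset1_supremums.
  split=> [_ [y y1 <-]|b]; first exact: le_trans (phi_le y) y1.
  apply; exists (`|x|^-1 *: x).
    by rewrite /= normrZ normfV normr_id mulVf// gt_eqF.
  rewrite (functionalZ _ _ lphi) phix normrM normfV !normr_id mulVf// gt_eqF//.
Qed.

End support.

(** * The peak filter and its functionals *)

Section peak.
Context d (X : measurableType d) (R : realType) (k : scalar_kind).
Variable lambda : {measure set X -> \bar R}.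
Local Notation K := (scalar_field R k).
Implicit Types (f g h : Linf k lambda) (B S : set X) (U : set_system X).

Lemma Linf_preimage_measurable f (W : set K) :
  open W -> measurable (f @^-1` W).
Proof.
by have /ess_boundedP[/borel_measurableP mf _] := valP (repr f); exact: mf.
Qed.

Lemma Linf_modulus_gt_measurable f (r : R) :
  measurable [set x | r < modulus (f x)].
Proof.
apply: (@Linf_preimage_measurable f [set z | r < modulus z]).
exact: open_modulus_gt.
Qed.

Lemma Linf_norm_gt0 f : f != 0 -> 0 < Linf_norm f.
Proof.
by rewrite -normr_gt0 Linf_normE -(@of_real0 R k) ltr_of_real.
Qed.

Lemma Linf_restrict f B : measurable B ->
  exists g, \forall x \ae lambda, g x = if x \in B then f x else 0.
Proof.
move=> mB; pose fB x := if x \in B then f x else 0.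
have bfB : fB \in @ess_bounded _ X R k lambda.
  apply/ess_boundedP; split.
    apply/borel_measurableP => W oW.
    have -> : fB @^-1` W = (B `&` f @^-1` W) `|` (~` B `&` (fun=> 0) @^-1` W).
      apply/seteqP; split=> x; rewrite /fB /=.
        by case: ifPn => [/set_mem|/negP Bx] Wx; [left|right; split=> // /mem_set].
      by move=> [[/mem_set -> //]|[Bx W0]]; rewrite memNset.
    apply: measurableU; apply: measurableI => //.
    - exact: Linf_preimage_measurable.
    - exact: measurableC.
    - by rewrite preimage_cst; case: ifP.
  apply/ess_norm_ltyP; exists (Linf_norm f); first exact: Linf_norm_ge0.
  apply: filterS (ae_le_Linf_norm f) => x fx; rewrite /fB; case: ifP => // _.
  by rewrite modulus0 Linf_norm_ge0.
exists (\pi_(Linf k lambda)%qT (EssBoundedFun bfB)); exact: Linf_piE.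
Qed.

Definition peak_filter f : set_system X :=
  [set S | exists2 e : R, 0 < e &
     \forall x \ae lambda, Linf_norm f - e < modulus (f x) -> S x].

Lemma peak_filter_ae f S : (\forall x \ae lambda, S x) -> peak_filter f S.
Proof. by move=> aeS; exists 1 => //; apply: filterS aeS. Qed.

Lemma peak_filter_ge f (e : R) : 0 < e ->
  peak_filter f [set x | Linf_norm f - e < modulus (f x)].
Proof. by move=> e0; exists e => //; exact: aeW. Qed.

(** A peak is not null, by definition of the essential supremum. *)
Lemma peak_filter_proper f : f != 0 -> ProperFilter (peak_filter f).
Proof.
move=> f0; split; last split.
- move=> [e e0 fe].
  (* [|f|_oo - e] may be negative, while a bound on the norm may not *)
  have [] : ~ (Linf_norm f <= Num.max 0 (Linf_norm f - e)).
    apply/negP; rewrite -ltNge gt_max Linf_norm_gt0//.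
    by rewrite ltrBlDr ltrDl.
  apply/Linf_norm_leP; first by rewrite le_max lexx.
  apply: filterS fe => x /negP; rewrite -leNgt => xe.
  by rewrite le_max xe orbT.
- by apply: peak_filter_ae; exact: aeW.
- move=> S T [e e0 eS] [e' e'0 eT]; exists (Num.min e e').
    by rewrite lt_min e0.
  apply: filterS2 eS eT => x Sx Tx xe; split; [apply: Sx|apply: Tx].
    by apply: le_lt_trans xe; rewrite lerB// ge_min lexx.
  by apply: le_lt_trans xe; rewrite lerB// ge_min lexx orbT.
- move=> S T ST [e e0 eS]; exists e => //; apply: filterS eS => x Sx xe.
  exact/ST/Sx.
Qed.

(** Multiplying by the phase [|f| / f] instead of dividing by [f] keeps the
    integrand below [|g|] everywhere: the phase is [0] where [f] vanishes. *)
Definition peak_functional f U g : K :=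
  lim (g x * (`|f x| / f x) @[x --> U]).

Section peak_functional_theory.
Variables (f : Linf k lambda) (U : set_system X).
Hypotheses (f0 : f != 0) (UU : UltraFilter U) (fU : peak_filter f `<=` U).

Lemma modulus_peak_phase x g :
  modulus (g x * (`|f x| / f x)) <= modulus (g x).
Proof.
rewrite modulusM -[leRHS]mulr1 ler_wpM2l ?modulus_ge0// ler_modulus_norm.
rewrite of_real1 normrM normfV normr_id.
by have [->|fx0] := eqVneq (f x) 0; rewrite ?normr0 ?mul0r// divff ?normr_eq0.
Qed.

Lemma modulus_peak_phase_le g :
  U [set x | modulus (g x * (`|f x| / f x)) <= Linf_norm g].
Proof.
apply/fU/peak_filter_ae; apply: filterS (ae_le_Linf_norm g) => x.
exact: le_trans (modulus_peak_phase _ _).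
Qed.

Lemma cvg_peak_functional g :
  g x * (`|f x| / f x) @[x --> U] --> peak_functional f U g.
Proof.
have [l gl] := ultra_cvg_scalar UU (modulus_peak_phase_le g).
by apply: cvgP gl.
Qed.

Lemma peak_functional_unique g (h : X -> K) (l : K) :
  U [set x | g x * (`|f x| / f x) = h x] -> h x @[x --> U] --> l ->
  peak_functional f U g = l.
Proof.
move=> gh hl; have gl : g x * (`|f x| / f x) @[x --> U] --> l.
  by apply: cvg_trans hl; apply: near_eq_cvg; apply: filterS gh => x ->.
exact: cvg_lim gl.
Qed.

Lemma peak_functional_linear : linear (peak_functional f U : Linf k lambda -> K^o).
Proof.
suff lin (a : K) g h : peak_functional f U (a *: g + h) =
    a * peak_functional f U g + peak_functional f U h by move=> a g h; exact: lin.
apply: (@peak_functional_unique _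
    (fun x => a * (g x * (`|f x| / f x)) + h x * (`|f x| / f x))).
  apply/fU/peak_filter_ae; apply: filterS2 (LinfDE (a *: g) h) (LinfZE a g).
  by move=> x gh ag; rewrite /= gh ag mulrDl mulrA.
apply: cvgD; last exact: cvg_peak_functional.
by apply: cvgM; [exact: cvg_cst|exact: cvg_peak_functional].
Qed.

(** [U] contains both the conull set [{|f| <= |f|_oo}] and every peak. *)
Lemma cvg_peak_norm : `|f x| @[x --> U] --> `|f|.
Proof.
apply/cvgrPdist_lt => _ /gt0_of_real[e e0 ->].
have := fU (peak_filter_ge f e0); have := fU (peak_filter_ae f (ae_le_Linf_norm f)).
apply: filterS2 => x /= fx xf.
rewrite Linf_normE -of_real_modulus -of_realN -of_realD of_real_norm ltr_of_real.
by rewrite ger0_norm ?subr_ge0// ltrBlDr -ltrBlDl.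
Qed.

Lemma peak_functional_eq g : U [set x | g x = f x] -> peak_functional f U g = `|f|.
Proof.
move=> gf; apply: (peak_functional_unique _ cvg_peak_norm).
apply: filterS gf => x /= ->; have [->|fx0] := eqVneq (f x) 0.
  by rewrite normr0 !mul0r.
by rewrite mulrC divfK.
Qed.

Lemma peak_functional_eq0 g : U [set x | g x = 0] -> peak_functional f U g = 0.
Proof.
move=> g0; apply: (@peak_functional_unique _ (fun=> 0)); last exact: cvg_cst.
by apply: filterS g0 => x /= ->; rewrite mul0r.
Qed.

Lemma peak_functional_support : support_functionals f (peak_functional f U).
Proof.
apply/support_functionalsP => //; split; first exact: peak_functional_linear.
  move=> g; rewrite Linf_normE.
  exact: (cvg_norm_le _ (modulus_peak_phase_le g) (@cvg_peak_functional g)).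
by apply: peak_functional_eq; exact: filterE.
Qed.

End peak_functional_theory.

(** An ultrafilter containing [B] sends the restriction of [f] to [B] to the
    norm of [f], and an ultrafilter containing [~` B] sends it to [0]; both
    ultrafilters exist if the peak filter does not decide [B]. *)
Lemma smooth_decides f B : smooth f -> measurable B ->
  peak_filter f B \/ peak_filter f (~` B).
Proof.
move=> [f0 [phi sphi]] mB; apply: contrapT => /not_orP[nB nCB].
have PF := peak_filter_proper f0.
have ultra C : ~ peak_filter f (~` C) ->
    exists U, [/\ UltraFilter U, peak_filter f `<=` U & U C].
  move=> nC; have PW : ProperFilter (within C (peak_filter f)).
    split; last exact: within_filter.
    by move=> WC; apply: nC; exact: WC.
  have [U [UU sU]] := ultraFilterLemma PW; exists U; split=> //.
    move=> S FS; apply: sU.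
    suff : peak_filter f [set x | C x -> S x] by [].
    by apply: filterS FS => x Sx _.
  by apply: sU; exact: withinT.
have [U [UU fU UB]] := ultra _ nCB.
have [|U' [UU' fU' UB']] := ultra (~` B); first by rewrite setCK.
have [g gE] := Linf_restrict f mB.
have := peak_functional_support f0 UU fU; rewrite sphi => /= phiU.
have := peak_functional_support f0 UU' fU'; rewrite sphi -phiU => UU'E.
have : peak_functional f U' g = 0.
  apply: peak_functional_eq0 => //.
  apply: filterS2 UB' (fU' _ (peak_filter_ae f gE)) => x /= Bx ->.
  by rewrite memNset.
rewrite UU'E peak_functional_eq// => [/normr0_eq0/eqP|]; first exact/negP.
apply: filterS2 UB (fU _ (peak_filter_ae f gE)) => x /= Bx ->.
by rewrite mem_set.
Qed.

End peak.

(** * Atoms *)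

Section atoms.
Context d (X : measurableType d) (R : realType) (k : scalar_kind).
Variable lambda : {measure set X -> \bar R}.
Local Notation K := (scalar_field R k).
Implicit Types (f g h : Linf k lambda) (A B S : set X).

Lemma ae_notin_null B : lambda B = 0%E -> measurable B ->
  \forall x \ae lambda, ~ B x.
Proof.
by move=> B0 mB; exists B; split => // x /= /contrapT.
Qed.

Lemma null_ae_notin B : measurable B -> (\forall x \ae lambda, ~ B x) ->
  lambda B = 0%E.
Proof.
by move=> mB aeB; apply/negligibleP => //; apply: negligibleS aeB => x Bx /(_ Bx).
Qed.

(** The sets that contain [A] up to a null set form a filter. The constant is
    the limit [c] of [g] along an ultrafilter above it: the part of [A] where
    [g] is within [1 / (n + 1)] of [c] belongs to the ultrafilter, so it is not
    null and is a.e. all of the atom. *)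
Lemma atom_ae_const A g : atom lambda A ->
  exists c : K, \forall x \ae lambda, A x -> g x = c.
Proof.
move=> [mA A0 atA].
have PF : ProperFilter (within A (almost_everywhere lambda)).
  split; last exact: within_filter.
  move=> A_null; have /eqP := null_ae_notin mA A_null.
  by rewrite gt_eqF.
have [U [UU sU]] := ultraFilterLemma PF.
have aeU S : (\forall x \ae lambda, A x -> S x) -> U S by exact: sU.
have [|c gc] := @ultra_cvg_scalar _ _ _ U g (Linf_norm g) UU.
  by apply: aeU; apply: filterS (ae_le_Linf_norm g).
exists c.
pose D n := g @^-1` ball c (of_real k n.+1%:R^-1).
have mD n : measurable (D n).
  by apply: Linf_preimage_measurable; apply: ball_open;
    rewrite -(@of_real0 R k) ltr_of_real.
have D_ae n : \forall x \ae lambda, A x -> D n x.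
  have UD : U (D n).
    have : nbhs c (ball c (of_real k n.+1%:R^-1)).
      by apply: nbhsx_ballx; rewrite -(@of_real0 R k) ltr_of_real.
    exact: gc.
  have AD0 : (0 < lambda (A `&` D n))%E.
    rewrite lt0e measure_ge0 andbT; apply/eqP => AD0.
    have UnD : U (~` D n).
      apply: aeU; apply: filterS (ae_notin_null AD0 _); last exact: measurableI.
      by move=> x nAD Ax Dx; exact: nAD.
    have : U set0 by rewrite -(setICr (D n)); exact: filterI.
    exact: filter_not_empty.
  have mAD := measurableI _ _ mA (mD n).
  have AnD := atA _ mAD (@subIsetl _ _ _) AD0.
  apply: filterS (ae_notin_null AnD (measurableD mA mAD)) => x nx Ax.
  by apply: contrapT => nDx; apply: nx; split => // -[].
have := ae_foralln D_ae; apply: filterS => x Dx Ax.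
apply/eqP; rewrite eq_sym -subr_eq0; apply/eqP/modulus_le0/ler_addgt0Pr => e e0.
rewrite add0r; have n_e : (Num.truncn e^-1).+1%:R^-1 < e.
  by rewrite invf_plt ?posrE ?ltr0n// truncnS_gt.
have := Dx (Num.truncn e^-1) Ax; rewrite /D -ball_normE /= -of_real_modulus.
by rewrite ltr_of_real => /ltW/le_trans; apply; exact: ltW.
Qed.

(** Perturb [f] by [u *: h], where [u] is chosen so that [u *: h] has norm [e]
    and [u * psi h] is positive. The norm stays at most [|f|], because [h]
    vanishes on [A] and there is room [e] off [A], whereas [psi] would take a
    value greater than [|f|] if [psi h] were not [0]. *)
Lemma support_functional_eq0 f h A (e : R) (psi : Linf k lambda -> K) :
  f != 0 -> 0 < e -> support_functionals f psi ->
  (\forall x \ae lambda, ~ A x -> modulus (f x) <= Linf_norm f - e) ->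
  (\forall x \ae lambda, A x -> h x = 0) -> psi h = 0.
Proof.
move=> f0 e0 /(support_functionalsP _ f0)[lpsi psi_le psif] fA hA.
apply/eqP/negP => /negP psih.
have h0 : h != 0 by apply: contraNN psih => /eqP ->; rewrite (functional0 lpsi).
have nh0 : 0 < `|h| by rewrite normr_gt0.
have eK0 : 0 < of_real k e by rewrite -(@of_real0 R k) ltr_of_real.
pose u := `|psi h| / psi h * (of_real k e / `|h|).
have fuh : `|f + u *: h| <= `|f|.
  rewrite !Linf_normE ler_of_real; apply/Linf_norm_leP; first exact: Linf_norm_ge0.
  have uh_norm : Linf_norm (u *: h) = e.
    apply: (@of_real_inj R k); rewrite -[LHS]/(`|u *: h|) normrZ !normrM !normfV.
    by rewrite !normr_id divff ?mul1r ?normr_eq0// gtr0_norm// divfK ?gt_eqF.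
  near=> x; rewrite (near (LinfDE f (u *: h)) x)//.
  have [Ax|nAx] := pselect (A x).
    rewrite (near (LinfZE u h) x)// (near hA x)// mulr0 addr0.
    by rewrite (near (ae_le_Linf_norm f) x).
  rewrite (le_trans (ler_modulusD _ _))// -[leRHS](subrK e) lerD//.
    by apply: (near fA x).
  by rewrite -uh_norm; apply: (near (ae_le_Linf_norm (u *: h)) x).
have := le_trans (psi_le _) fuh.
rewrite (functionalD _ _ lpsi) (functionalZ _ _ lpsi) psif.
have t0 : 0 < `|psi h| * (of_real k e / `|h|).
  by rewrite mulr_gt0 ?divr_gt0 ?normr_gt0.
rewrite /u mulrAC divfK// ger0_norm; last by rewrite addr_ge0// ltW.
by rewrite gerDl => /le_gtF; rewrite t0.
Unshelve. all: by end_near. Qed.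

(** If [g = c] and [f = a] a.e. on [A], then [g - (c / a) *: f] vanishes a.e.
    on [A], so any support functional sends [g] to [c / a * |f|]. *)
Lemma support_functional_unique f A (e : R) (psi psi' : Linf k lambda -> K) :
  f != 0 -> 0 < e -> atom lambda A ->
  (\forall x \ae lambda, A x -> modulus (f x) = Linf_norm f) ->
  (\forall x \ae lambda, ~ A x -> modulus (f x) <= Linf_norm f - e) ->
  support_functionals f psi -> support_functionals f psi' -> psi = psi'.
Proof.
move=> f0 e0 atA f_A f_nA Jpsi Jpsi'; apply/funext => g.
have [c gc] := atom_ae_const g atA; have [a fa] := atom_ae_const f atA.
have a0 : a != 0.
  apply/eqP => a0; have [mA A0 _] := atA.
  have /(null_ae_notin mA)/eqP : \forall x \ae lambda, ~ A x; last first.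
    by rewrite gt_eqF.
  apply: filterS2 f_A fa => x fx fxa Ax; move: (fx Ax).
  rewrite fxa// a0 modulus0 => f_0.
  by have := Linf_norm_gt0 f0; rewrite -f_0 ltxx.
have psiE phi : support_functionals f phi -> phi g = c / a * `|f|.
  move=> Jphi; have /(support_functionalsP _ f0)[lphi _ phif] := Jphi.
  apply/eqP; rewrite -phif -(functionalZ _ _ lphi) -subr_eq0.
  rewrite -(functionalB _ _ lphi); apply/eqP.
  apply: (support_functional_eq0 f0 e0 Jphi f_nA).
  rewrite -scaleNr; near=> x => Ax.
  rewrite (near (LinfDE g (- (c / a) *: f)) x)// (near (LinfZE (- (c / a)) f) x)//.
  by rewrite (near gc x)// (near fa x)// mulNr divfK// subrr.
by rewrite !psiE.
Unshelve. all: by end_near. Qed.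

(** The peaks [{|f| > |f|_oo - 1 / (n + 1)}] generate the peak filter up to null
    sets, so [decided_atom] applies to them. Off the peak that it yields, [|f|]
    is bounded away from [|f|_oo] at every point. *)
Lemma smooth_peak_atom f : smooth f -> exists A (e : R),
  [/\ atom lambda A, 0 < e,
      \forall x \ae lambda, A x -> modulus (f x) = Linf_norm f &
      forall x, ~ A x -> modulus (f x) <= Linf_norm f - e].
Proof.
move=> sf; have f0 := sf.1; have PF := peak_filter_proper f0.
pose E n := [set x | Linf_norm f - n.+1%:R^-1 < modulus (f x)].
have mE n : measurable (E n) by exact: Linf_modulus_gt_measurable.
have dE n m : (n <= m)%N -> E m `<=` E n.
  move=> nm x; apply: le_lt_trans; rewrite lerB// lef_pV2 ?posrE ?ltr0n//.
  by rewrite ler_nat.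
have invn0 n : 0 < n.+1%:R^-1 :> R by rewrite invr_gt0.
have E0 n : (0 < lambda (E n))%E.
  rewrite lt0e measure_ge0 andbT; apply/eqP => En0.
  have nEn : peak_filter f (~` E n).
    by apply: peak_filter_ae; exact: ae_notin_null.
  have : peak_filter f set0.
    by rewrite -(setICr (E n)); apply: filterI => //; exact: peak_filter_ge.
  exact: filter_not_empty.
have peakE S : measurable S -> peak_filter f (~` S) ->
    exists n, lambda (E n `&` S) = 0%E.
  move=> mS [e e_gt0 eS]; exists (Num.truncn e^-1).
  apply: null_ae_notin; first exact: measurableI.
  apply: filterS eS => x nS [Ex]; apply: nS; apply: le_lt_trans Ex.
  by rewrite lerB// ltW// invf_plt ?posrE ?ltr0n// truncnS_gt.
have [|n [atE nE]] := decided_atom mE dE E0.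
  move=> B mB; have [FB|FB] := smooth_decides sf mB.
    have [||n] := peakE (~` B); rewrite ?setCK//; first exact: measurableC.
    by rewrite -setDE => nB; exists n; right.
  by have [n] := peakE _ mB FB; exists n; left.
exists (E n), n.+1%:R^-1; split => //; last first.
  by move=> x /negP; rewrite -leNgt.
have : forall m, \forall x \ae lambda, E n x -> E m x.
  move=> m; have /ae_notin_null/(_ (measurableD (mE n) (mE m))) := nE m.
  by apply: filterS => x nx Ex; apply: contrapT => nEm; exact: nx.
move=> /ae_foralln; apply: filterS2 (ae_le_Linf_norm f) => x fx Ex Enx.
apply/eqP; rewrite eq_le fx -subr_le0; apply/ler_addgt0Pr => e e_gt0.
have := Ex (Num.truncn e^-1) Enx; rewrite /E /= add0r ltrBlDr -ltrBlDl.
move=> /ltW/le_trans; apply; apply/ltW.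
by rewrite invf_plt ?posrE ?ltr0n// truncnS_gt.
Qed.

End atoms.

(** * Characterization of smooth functions *)

Theorem theorem2p2p4 (R : realType) (k : scalar_kind) (d : measure_display)
    (X : measurableType d) (lambda : {measure set X -> \bar R})
    (f : Linf k lambda) (f_neq0 : f != 0) :
  smooth f <->
  exists A : set X,
    [/\ atom lambda A,
        (\forall x \ae lambda, A x -> `|f x| = `|f|) &
        exists2 eps : scalar_field R k, 0 < eps &
          lambda (~` A `&` [set x | `|f| - eps < `|f x|]) = 0].
Proof.
have levelE (e : R) x :
    (`|f| - of_real k e < `|f x|) = (Linf_norm f - e < modulus (f x)).
  by rewrite Linf_normE -of_realN -of_realD -of_real_modulus ltr_of_real.
have normE x : `|f x| = `|f| <-> modulus (f x) = Linf_norm f.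
  rewrite Linf_normE -of_real_modulus.
  by split=> [/of_real_inj//|->].
split=> [/smooth_peak_atom[A [e [atA e0 fA fnA]]]|].
  exists A; split=> //; first by apply: filterS fA => x /[apply]/normE.
  exists (of_real k e); first by rewrite -(@of_real0 R k) ltr_of_real.
  rewrite (_ : _ `&` _ = set0) ?measure0//; apply/seteqP; split=> // x [nAx] /=.
  by rewrite levelE; apply/negP; rewrite -leNgt; exact: fnA.
move=> [A [atA fA [_ /gt0_of_real[e e0 ->] fnA]]]; split=> //.
have [U [UU fU]] := ultraFilterLemma (peak_filter_proper f_neq0).
exists (peak_functional f U); apply/seteqP; split=> [psi Jpsi|_ ->]; last first.
  exact: peak_functional_support.
have [mA _ _] := atA.
apply: (support_functional_unique f_neq0 e0 atA) => //.
- by apply: filterS fA => x /[apply]/normE.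
- apply: filterS (ae_notin_null fnA _).
    move=> x nx nAx; rewrite leNgt; apply/negP => fx; apply: nx; split=> //=.
    by rewrite levelE.
  apply: measurableI; first exact: measurableC.
  rewrite (_ : mkset _ = [set x | Linf_norm f - e < modulus (f x)]).
    exact: Linf_modulus_gt_measurable.
  by apply/seteqP; split=> x /=; rewrite levelE.
- exact: peak_functional_support.
Qed.
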